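(* If a sequent (in the language of $\backslash, /, \cdot, \wedge, \mathbf{1}, \mathbf{0}$) is true in all non-standard square R-models, then it is derivable (without hypotheses) in $\mathbf{L}^{\Lambda}\wedge\mathbf{0}\mathbf{1}$.
   Context: Formulae are built from a countable set of propositional variables and the constants $\mathbf{0}$ and $\mathbf{1}$ using the binary connectives $\cdot$, $\backslash$, $/$, $\wedge$. A sequent is $\Pi \to B$ with $B$ a formula and $\Pi$ a finite, possibly empty, sequence of formulae (empty sequence written $\Lambda$). The calculus $\mathbf{L}^{\Lambda}\wedge\mathbf{0}\mathbf{1}$ has the axioms $A \to A$, $\Gamma,\mathbf{0},\Delta \to C$ and $\Lambda \to \mathbf{1}$, and rules (capital Greek letters denote possibly empty sequences): (Cut) from $\Pi \to A$ and $\Gamma, A, \Delta \to C$ infer $\Gamma,\Pi,\Delta\to C$; ($\backslash L$) from $\Pi\to A$ and $\Gamma,B,\Delta\to C$ infer $\Gamma,\Pi,A\backslash B,\Delta\to C$; ($\backslash R$) from $A,\Pi\to B$ infer $\Pi\to A\backslash B$; ($/ L$) from $\Pi\to A$ and $\Gamma,B,\Delta\to C$ infer $\Gamma,B/A,\Pi,\Delta\to C$; ($/R$) from $\Pi,A\to B$ infer $\Pi\to B/A$; ($\cdot L$) from $\Gamma,A,B,\Delta\to C$ infer $\Gamma,A\cdot B,\Delta\to C$; ($\cdot R$) from $\Pi\to A$ and $\Delta\to B$ infer $\Pi,\Delta\to A\cdot B$; ($\wedge L$) from $\Gamma,A,\Delta\to C$ infer both $\Gamma,A\wedge B,\Delta\to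 C$ and $\Gamma,B\wedge A,\Delta\to C$; ($\wedge R$) from $\Pi\to A$ and $\Pi\to B$ infer $\Pi\to A\wedge B$; ($\mathbf{1} L$) from $\Gamma,\Delta\to C$ infer $\Gamma,\mathbf{1},\Delta\to C$. For binary relations $R,S$ on a non-empty set $W$: $R\circ S=\{(x,z) \mid \exists y\,((x,y)\in R, (y,z)\in S)\}$; $R\backslash S=\{(y,z)\in W\times W \mid \forall x\,((x,y)\in R\Rightarrow (x,z)\in S)\}$; $S/R=\{(x,y)\in W\times W \mid \forall z\,((y,z)\in R\Rightarrow(x,z)\in S)\}$; $\delta=\{(x,x)\mid x\in W\}$. A non-standard square R-model is a tuple $(W,\mathfrak{A},\mathbf{1}_{\mathfrak{A}},\mathbf{0}_{\mathfrak{A}},v)$ where $W$ is non-empty; $\mathfrak{A}$ is a family of binary relations on $W$ closed under $\circ,\backslash,/,\cap$; $\mathbf{1}_{\mathfrak{A}}\in\mathfrak{A}$ satisfies $\mathbf{1}_{\mathfrak{A}}\circ R=R\circ\mathbf{1}_{\mathfrak{A}}=R$ for all $R\in\mathfrak{A}$; $\mathbf{0}_{\mathfrak{A}}\in\mathfrak{A}$ satisfies $\mathbf{0}_{\mathfrak{A}}\subseteq R$ for all $R\in\mathfrak{A}$; and $v$ maps every formula to a member of $\mathfrak{A}$ with $v(A\cdot B)=v(A)\circ v(B)$, $v(A\backslash B)=v(A)\backslash v(B)$, $v(B/A)=v(B)/v(A)$, $v(A\wedge B)=v(A)\cap v(B)$, $v(\mathbf{1})=\mathbf{1}_{\mathfrak{A}}$,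 $v(\mathbf{0})=\mathbf{0}_{\mathfrak{A}}$. A sequent $A_1,\ldots,A_n\to B$ ($n\ge1$) is true in the model if $v(A_1)\circ\cdots\circ v(A_n)\subseteq v(B)$, and $\Lambda\to B$ is true if $\delta\subseteq v(B)$. *)

(* Defs.v *)
From mathcomp Require Import all_boot.
From mathcomp Require Import boolp classical_sets.

Set Implicit Arguments.
Unset Strict Implicit.
Unset Printing Implicit Defensive.

Local Open Scope classical_set_scope.

Inductive formula : Type :=
| Var of nat
| Zero
| One
| Prod of formula & formula
| LDiv of formula & formula (* [LDiv A B] is A \ B *)
| RDiv of formula & formula (* [RDiv B A] is B / A *)
| And of formula & formula.

Record sequent : Type := Sequent { antecedent : seq formula; succedent : formula }.

Declare Scope sequent_scope.
Delimit Scope sequent_scope with sequent.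
Notation "G |-- B" := (Sequent G B) (at level 65) : sequent_scope.
Local Open Scope sequent_scope.

Inductive derivable : sequent -> Prop :=
| ax_id A : derivable ([:: A] |-- A)
| ax_zero G D C : derivable (G ++ Zero :: D |-- C)
| ax_one : derivable ([::] |-- One)
| rule_cut P G D A C :
    derivable (P |-- A) -> derivable (G ++ A :: D |-- C) ->
    derivable (G ++ P ++ D |-- C)
| rule_ldivL P G D A B C :
    derivable (P |-- A) -> derivable (G ++ B :: D |-- C) ->
    derivable (G ++ P ++ LDiv A B :: D |-- C)
| rule_ldivR P A B :
    derivable (A :: P |-- B) -> derivable (P |-- LDiv A B)
| rule_rdivL P G D A B C :
    derivable (P |-- A) -> derivable (G ++ B :: D |-- C) ->
    derivable (G ++ RDiv B A :: P ++ D |-- C)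
| rule_rdivR P A B :
    derivable (P ++ [:: A] |-- B) -> derivable (P |-- RDiv B A)
| rule_prodL G D A B C :
    derivable (G ++ A :: B :: D |-- C) -> derivable (G ++ Prod A B :: D |-- C)
| rule_prodR P D A B :
    derivable (P |-- A) -> derivable (D |-- B) ->
    derivable (P ++ D |-- Prod A B)
| rule_andL1 G D A B C :
    derivable (G ++ A :: D |-- C) -> derivable (G ++ And A B :: D |-- C)
| rule_andL2 G D A B C :
    derivable (G ++ A :: D |-- C) -> derivable (G ++ And B A :: D |-- C)
| rule_andR P A B :
    derivable (P |-- A) -> derivable (P |-- B) -> derivable (P |-- And A B)
| rule_oneL G D C :
    derivable (G ++ D |-- C) -> derivable (G ++ One :: D |-- C).

Section Relations.
Variable W : Type.
Implicit Types R S : set (W * W).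

(* Diagrammatic order, unlike the library's [\;] in relation_scope. *)
Definition rcomp R S : set (W * W) :=
  [set p | exists y, R (p.1, y) /\ S (y, p.2)].

Definition rldiv R S : set (W * W) :=
  [set p | forall x, R (x, p.1) -> S (x, p.2)].

(* [rrdiv S R] is S / R *)
Definition rrdiv S R : set (W * W) :=
  [set p | forall z, R (p.2, z) -> S (p.1, z)].

End Relations.

Record ns_model : Type := NSModel {
  worlds : Type;
  worlds_inhabited : inhabited worlds;
  fam : set (set (worlds * worlds));
  fam_comp : forall R S, fam R -> fam S -> fam (rcomp R S);
  fam_ldiv : forall R S, fam R -> fam S -> fam (rldiv R S);
  fam_rdiv : forall S R, fam S -> fam R -> fam (rrdiv S R);
  fam_cap : forall R S, fam R -> fam S -> fam (R `&` S);
  munit : set (worlds * worlds);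
  fam_unit : fam munit;
  munit_compl : forall R, fam R -> rcomp munit R = R;
  munit_compr : forall R, fam R -> rcomp R munit = R;
  mzero : set (worlds * worlds);
  fam_zero : fam mzero;
  mzero_sub : forall R, fam R -> mzero `<=` R;
  vform : formula -> set (worlds * worlds);
  fam_val : forall A, fam (vform A);
  val_prod : forall A B, vform (Prod A B) = rcomp (vform A) (vform B);
  val_ldiv : forall A B, vform (LDiv A B) = rldiv (vform A) (vform B);
  val_rdiv : forall B A, vform (RDiv B A) = rrdiv (vform B) (vform A);
  val_and : forall A B, vform (And A B) = vform A `&` vform B;
  val_one : vform One = munit;
  val_zero : vform Zero = mzero
}.

Arguments fam : clear implicits.
Arguments munit : clear implicits.
Arguments mzero : clear implicits.
Arguments vform : clear implicits.

(* v(A) o v(A_2) o ... o v(A_n) for the nonempty sequence A :: [A_2; ...; A_n] *)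
Fixpoint comp_val (W : Type) (v : formula -> set (W * W))
    (A : formula) (G : seq formula) : set (W * W) :=
  if G is B :: G' then rcomp (v A) (comp_val v B G') else v A.

Definition true_in (M : ns_model) (s : sequent) : Prop :=
  match antecedent s with
  | [::] => @diagonal (worlds M) `<=` vform M (succedent s)
  | A :: G => comp_val (vform M) A G `<=` vform M (succedent s)
  end.

(* Main.v *)
From mathcomp Require Import all_boot.
From mathcomp Require Import boolp classical_sets.
Require Import Defs.

Set Implicit Arguments.
Unset Strict Implicit.
Unset Printing Implicit Defensive.

Local Open Scope classical_set_scope.
Local Open Scope sequent_scope.

(** Worlds form a labelled graph: a pair of worlds carries at most one sequence
    of formulae, and [v(A)] consists of the pairs whose label derives [A].
    Starting from one edge labelled by the antecedent, stage [n] adds, all at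
    once, a midpoint for every pair of distinct points whose label derives a
    product, and, for every point and formula, a fresh predecessor and a fresh
    successor witnessing the failure of divisions.  The graph is kept reflexive
    (with empty labels on the diagonal), antisymmetric, and transitive up to
    derivability.  No midpoint is ever put on a loop: by a slash argument,
    derivability of [Prod A B] from the empty antecedent already gives that of
    [A] and of [B]. *)

(** * The slash interpretation, for derivations from the empty antecedent *)

Fixpoint slash (F : formula) : Prop :=
  match F with
  | Var n => derivable ([::] |-- Var n)
  | Zero => False
  | One => True
  | Prod A B => slash A /\ slash B
  | LDiv A B => derivable ([::] |-- LDiv A B) /\ (slash A -> slash B)
  | RDiv B A => derivable ([::] |-- RDiv B A) /\ (slash A -> slash B)
  | And A B => slash A /\ slash B
  end.

Fixpoint slash_seq (G : seq formula) : Prop :=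
  if G is A :: G' then slash A /\ slash_seq G' else True.

Lemma slash_derivable A : slash A -> derivable ([::] |-- A).
Proof.
elim: A => //= [_|A IHA B IHB [sA sB]|A _ B _ []|B _ A _ []|A IHA B IHB [sA sB]] //.
- exact: ax_one.
- exact: (rule_prodR (IHA sA) (IHB sB)).
- exact: (rule_andR (IHA sA) (IHB sB)).
Qed.

Lemma slash_seq_cat G D : slash_seq (G ++ D) <-> slash_seq G /\ slash_seq D.
Proof. by elim: G => [|A G IH] /=; tauto. Qed.

Lemma slash_seq_cut P C : slash_seq P -> derivable (P |-- C) -> derivable ([::] |-- C).
Proof.
elim: P => //= A P IH [sA sP] dC; apply: IH => //.
exact: (@rule_cut [::] [::] P A C (slash_derivable sA) dC).
Qed.

(** By induction on the derivation; a cut composes two implications. The right division rules must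
    also derive the division from the empty antecedent, which follows by cutting away [P]. *)
Lemma slash_sound s :
  derivable s -> slash_seq (antecedent s) -> slash (succedent s).
Proof.
elim=> {s} /=.
- by move=> A [].
- by move=> G D C /slash_seq_cat[_ []].
- by [].
- move=> P G D A C _ IHA _ IHC /slash_seq_cat[sG /slash_seq_cat[sP sD]].
  by apply: IHC; apply/slash_seq_cat; split=> //=; split=> //; apply: IHA.
- move=> P G D A B C _ IHA _ IHC
    /slash_seq_cat[sG /slash_seq_cat[sP /= [[_ AB] sD]]].
  by apply: IHC; apply/slash_seq_cat; split=> //=; split=> //; apply/AB/IHA.
- move=> P A B dB IH sP; split; last by move=> sA; apply: IH.
  by apply: (slash_seq_cut sP); apply: rule_ldivR.
- move=> P G D A B C _ IHA _ IHC
    /slash_seq_cat[sG /= [[_ AB] /slash_seq_cat[sP sD]]].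
  by apply: IHC; apply/slash_seq_cat; split=> //=; split=> //; apply/AB/IHA.
- move=> P A B dB IH sP; split.
    by apply: (slash_seq_cut sP); apply: rule_rdivR.
  by move=> sA; apply: IH; apply/slash_seq_cat.
- move=> G D A B C _ IH /slash_seq_cat[sG /= [[sA sB] sD]].
  by apply: IH; apply/slash_seq_cat.
- by move=> P D A B _ IHA _ IHB /slash_seq_cat[sP sD]; split; [apply: IHA|apply: IHB].
- move=> G D A B C _ IH /slash_seq_cat[sG /= [[sA sB] sD]].
  by apply: IH; apply/slash_seq_cat.
- move=> G D A B C _ IH /slash_seq_cat[sG /= [[sA sB] sD]].
  by apply: IH; apply/slash_seq_cat.
- by move=> P A B _ IHA _ IHB sP; split; [apply: IHA|apply: IHB].
- move=> G D C _ IH /slash_seq_cat[sG /= [_ sD]].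
  by apply: IH; apply/slash_seq_cat.
Qed.

Lemma derivable_prod A B : derivable ([::] |-- Prod A B) ->
  derivable ([::] |-- A) /\ derivable ([::] |-- B).
Proof. by case/slash_sound=> // /slash_derivable dA /slash_derivable dB. Qed.

(** * Inversion of the divisions and comparison of labels *)

Lemma cut1 P A C : derivable (P |-- A) -> derivable ([:: A] |-- C) ->
  derivable (P |-- C).
Proof. by move=> dA dC; have := @rule_cut P [::] [::] A C dA dC; rewrite cats0. Qed.

Lemma derivable_ldiv_inv P A B :
  derivable (P |-- LDiv A B) -> derivable (A :: P |-- B).
Proof.
move=> d; have := @rule_cut P [:: A] [::] (LDiv A B) B d; rewrite cats0; apply.
exact: (@rule_ldivL [:: A] [::] [::] A B B (ax_id A) (ax_id B)).
Qed.

Lemma derivable_rdiv_inv P A B :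
  derivable (P |-- RDiv B A) -> derivable (P ++ [:: A] |-- B).
Proof.
move=> d; apply: (@rule_cut P [::] [:: A] (RDiv B A) B d).
exact: (@rule_rdivL [:: A] [::] [::] A B B (ax_id A) (ax_id B)).
Qed.

(** Amounts to deriving the product of [Q] from [P]; quantifying over contexts makes compatibility
    with concatenation immediate. *)
Definition stronger (P Q : seq formula) : Prop :=
  forall G D C, derivable (G ++ Q ++ D |-- C) -> derivable (G ++ P ++ D |-- C).

Lemma stronger_trans Q P S : stronger P Q -> stronger Q S -> stronger P S.
Proof. by move=> PQ QS G D C /QS/PQ. Qed.

Lemma stronger_cat P P' Q Q' :
  stronger P Q -> stronger P' Q' -> stronger (P ++ P') (Q ++ Q').
Proof.
move=> PQ PQ' G D C; rewrite -!catA => /PQ d.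
by have := PQ' (G ++ P) D C; rewrite -!catA; apply.
Qed.

Lemma stronger_derivable P Q C :
  stronger P Q -> derivable (Q |-- C) -> derivable (P |-- C).
Proof. by move=> /(_ [::] [::] C); rewrite !cats0. Qed.

Lemma stronger_prod P A B :
  derivable (P |-- Prod A B) -> stronger P [:: A; B].
Proof. by move=> d G D C /rule_prodL; apply: rule_cut. Qed.

(** * The stages *)

(* The first argument of [Mid], [Lft], [Rgt] is the stage that inserts the point. *)
Inductive point : Type :=
| Base of bool
| Mid of nat & point & formula & formula & point
| Lft of nat & formula & point
| Rgt of nat & point & formula.

(** Shifted by one: a point tagged [n] gets its edges in [stage G n.+1], and level 0 is kept for the
    base points. *)
Definition level (x : point) : nat :=
  match x with
  | Base _ => 0
  | Mid n _ _ _ _ | Lft n _ _ | Rgt n _ _ => n.+1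
  end.

Definition labelling : Type := point -> point -> option (seq formula).

Definition splits (l : labelling) x A B y : Prop :=
  x <> y /\ exists2 P, l x y = Some P & derivable (P |-- Prod A B).

(* A point tagged [n] whose data do not describe a defect of [l] is left isolated. *)
Definition inserted n (l : labelling) (z : point) : Prop :=
  match z with
  | Base _ => False
  | Mid m x A B y => m = n /\ splits l x A B y
  | Lft m _ _ | Rgt m _ _ => m = n
  end.

(** The last old point on the way into [z], with the label of the remaining edge; an old [z] is its
    own entry. [None] means that no old point precedes [z]. [exit] is the mirror image. *)
Definition entry n (l : labelling) (z : point) : option (point * seq formula) :=
  if `[< inserted n l z >] then
    match z with
    | Base _ | Lft _ _ _ => None
    | Mid _ x A _ _ | Rgt _ x A => Some (x, [:: A])
    end
  else Some (z, [::]).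

Definition exit n (l : labelling) (z : point) : option (point * seq formula) :=
  if `[< inserted n l z >] then
    match z with
    | Base _ | Rgt _ _ _ => None
    | Mid _ _ _ B y | Lft _ B y => Some (y, [:: B])
    end
  else Some (z, [::]).

(** An edge leaves [x] through its exit, follows an edge of [l], and reaches [y] through its entry.
    Loops at inserted points are put in directly. *)
Definition extend n (l : labelling) : labelling := fun x y =>
  if `[< inserted n l x /\ x = y >] then Some [::]
  else if exit n l x is Some (a, P) then
    if entry n l y is Some (b, Q) then
      if l a b is Some T then Some (P ++ T ++ Q) else None
    else None
  else None.

Fixpoint stage (G : seq formula) (n : nat) : labelling :=
  if n is m.+1 then extend m (stage G m) else fun x y =>
    if `[< x = y >] then Some [::]
    else if `[< x = Base false /\ y = Base true >] then Some G else None.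

Record coherent (l : labelling) : Prop := Coherent {
  coherent_refl : forall x, l x x = Some [::];
  coherent_anti : forall x y, l x y -> l y x -> x = y;
  coherent_trans : forall x y z P Q, l x y = Some P -> l y z = Some Q ->
    exists2 S, l x z = Some S & stronger S (P ++ Q)
}.

Lemma extendP n l x y P : extend n l x y = Some P ->
  [/\ inserted n l x, x = y & P = [::]] \/
  ~ (inserted n l x /\ x = y) /\ exists a b P1 P2 P3,
    [/\ exit n l x = Some (a, P1), entry n l y = Some (b, P3),
        l a b = Some P2 & P = P1 ++ P2 ++ P3].
Proof.
rewrite /extend; case: asboolP => [[ix xy] [<-]|nxy]; first by left.
case Ex: exit => [[a P1]|] //; case Ey: entry => [[b P3]|] //.
case El: (l a b) => [P2|] // [<-]; right; split=> //.
by exists a, b, P1, P2, P3.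
Qed.

Lemma extend_via n l x y a b P Q S :
  ~ (inserted n l x /\ x = y) -> exit n l x = Some (a, P) ->
  entry n l y = Some (b, Q) -> l a b = Some S ->
  extend n l x y = Some (P ++ S ++ Q).
Proof. by move=> nxy Ex Ey El; rewrite /extend; case: asboolP => // _; rewrite Ex Ey El. Qed.

Lemma entry_old n l x : ~ inserted n l x -> entry n l x = Some (x, [::]).
Proof. by rewrite /entry; case: asboolP. Qed.

Lemma exit_old n l x : ~ inserted n l x -> exit n l x = Some (x, [::]).
Proof. by rewrite /exit; case: asboolP. Qed.

(** Only midpoints have both an entry and an exit among inserted points, and there the old edge is
    the one being split: its label derives the product, and its ends are distinct. *)
Lemma entry_exit n l x a b P Q : coherent l ->
  entry n l x = Some (b, P) -> exit n l x = Some (a, Q) ->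
  (exists2 S, l b a = Some S & stronger S (P ++ Q)) /\
  (if `[< inserted n l x >] then b <> a else b = x /\ a = x).
Proof.
move=> cl; rewrite /entry /exit; case: asboolP => [ix|_]; last first.
  by move=> [<- <-] [<- <-]; split=> //; exists [::] => //; apply: coherent_refl.
case: x ix => // m x A B y [_ [nxy [S lS dS]]] [<- <-] [<- <-]; split=> //.
by exists S => //; apply: stronger_prod.
Qed.

Lemma coherent_le_trans l x y z : coherent l -> l x y -> l y z -> l x z.
Proof.
move=> cl; case Exy: (l x y) => [P|] // _; case Eyz: (l y z) => [Q|] // _.
by have [S ->] := coherent_trans cl Exy Eyz.
Qed.

Lemma extend_coherent n l : coherent l -> coherent (extend n l).
Proof.
move=> cl; split.
- move=> x; case: (pselect (inserted n l x)) => ix.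
    by rewrite /extend; case: asboolP => // -[].
  by rewrite (extend_via _ (exit_old ix) (entry_old ix) (coherent_refl cl x)) // => -[].
- move=> x y.
  case Exy: (extend n l x y) => [P|] // _; case Eyx: (extend n l y x) => [Q|] // _.
  case/extendP: Exy => [[]//|[_ [a [b' [P1 [P2 [P3 [xo yi lab _]]]]]]]].
  case/extendP: Eyx => [[]//|[_ [a' [b [Q1 [Q2 [Q3 [yo xi lab' _]]]]]]]].
  have [[S lx _] hx] := entry_exit cl xi xo.
  have [[T ly _] hy] := entry_exit cl yi yo.
  have ab' : l a b' by rewrite lab.
  have a'b : l a' b by rewrite lab'.
  have ba : l b a by rewrite lx.
  have b'a' : l b' a' by rewrite ly.
  (* The old points [a], [b'], [a'], [b] form a cycle in [l]. *)
  have Eab : b = a.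
    apply: (coherent_anti cl ba).
    exact: (coherent_le_trans cl ab' (coherent_le_trans cl b'a' a'b)).
  have Eab' : b' = a'.
    apply: (coherent_anti cl b'a').
    exact: (coherent_le_trans cl a'b (coherent_le_trans cl ba ab')).
  (* Equal entry and exit exclude inserted points, so [x] and [y] are both old. *)
  move: hx hy; case: asboolP => // _ [_ ax]; case: asboolP => // _ [b'y _].
  rewrite -ax -b'y; apply: (coherent_anti cl) => //.
  by rewrite Eab' -Eab.
- move=> x y z P Q Exy Eyz; case/extendP: (Exy) => [[_ xy ->]|].
    by rewrite -xy in Eyz; exists Q.
  move=> [nxy [a [b' [P1 [P2 [P3 [xo yi lab ->]]]]]]].
  case/extendP: (Eyz) => [[_ yz ->]|].
    by exists (P1 ++ P2 ++ P3); rewrite ?cats0 // -yz (extend_via nxy xo yi lab).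
  move=> [nyz [a' [b [Q1 [Q2 [Q3 [yo zi lab' ->]]]]]]].
  (* The passage through [y], labelled [P3 ++ Q1], is replaced by the old edge from its entry to its
     exit. *)
  have [[S ly sS] hy] := entry_exit cl yi yo.
  have [T1 lT1 sT1] := coherent_trans cl lab ly.
  have [T lT sT] := coherent_trans cl lT1 lab'.
  exists (P1 ++ T ++ Q3).
    (* If [x = z] were inserted, its entry and exit would be related both ways, hence equal. *)
    apply: (extend_via _ xo zi lT) => -[ix xz]; rewrite -xz in zi.
    have [[U lx _] hx] := entry_exit cl zi xo.
    move: hx; case: asboolP => // _; apply.
    by apply: (coherent_anti cl); rewrite ?lx ?lT.
  have -> : (P1 ++ P2 ++ P3) ++ Q1 ++ Q2 ++ Q3 =
            P1 ++ ((P2 ++ (P3 ++ Q1)) ++ Q2) ++ Q3 by rewrite -!catA.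
  apply: stronger_cat => //; apply: stronger_cat => //.
  apply: (stronger_trans sT); apply: stronger_cat => //.
  by apply: (stronger_trans sT1); apply: stronger_cat.
Qed.

Lemma stage_coherent G n : coherent (stage G n).
Proof.
elim: n => [|n IH]; last exact: extend_coherent.
split=> /=.
- by move=> x; case: asboolP.
- move=> x y; case: asboolP => // nxy; case: asboolP => // -[-> ->].
  by case: asboolP => // _; case: asboolP => // -[].
- move=> x y z P Q; case: asboolP => [-> [<-]|nxy]; first by exists Q.
  case: asboolP => // -[-> ->] [<-]; case: asboolP => [<- [<-]|nyz].
    by case: asboolP => // _; case: asboolP => [_|[] //]; exists G; rewrite ?cats0.
  by case: asboolP => // -[].
Qed.

Lemma level_not_inserted n l x : level x <= n -> ~ inserted n l x.
Proof.
by case: x => [b _ []|m x A B y /= + [Em _]|m A y /= + Em|m x A /= + Em];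
  rewrite Em ltnn.
Qed.

Lemma extend_old n l x y :
  level x <= n -> level y <= n -> extend n l x y = l x y.
Proof.
move=> /(@level_not_inserted n l) ix /(@level_not_inserted n l) iy.
rewrite /extend; case: asboolP => [[]//|_].
by rewrite exit_old // entry_old //; case: (l x y) => // P; rewrite cats0.
Qed.

(** * The limit labelling *)

(** Reads a pair at the first stage where both points are present; later stages no longer change its
    label. *)
Definition label (G : seq formula) : labelling :=
  fun x y => stage G (maxn (level x) (level y)) x y.

Lemma stage_label G n x y :
  level x <= n -> level y <= n -> stage G n x y = label G x y.
Proof.
move=> lx ly; have : maxn (level x) (level y) <= n by rewrite geq_max lx.
elim: n {lx ly} => [|n IH]; rewrite /label.
  by rewrite leqn0 => /eqP ->.
rewrite leq_eqVlt => /orP[/eqP -> //|]; rewrite ltnS => le_n.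
move: (le_n); rewrite geq_max => /andP[lx ly] /=.
by rewrite extend_old // IH.
Qed.

Lemma label_coherent G : coherent (label G).
Proof.
split.
- by move=> x; apply: (coherent_refl (stage_coherent G _)).
- move=> x y; rewrite /label (maxnC (level y)).
  exact: (coherent_anti (stage_coherent G _)).
- move=> x y z P Q.
  pose n := maxn (level x) (maxn (level y) (level z)).
  have [lx ly lz] : [/\ level x <= n, level y <= n & level z <= n].
    by rewrite /n !leq_max !leqnn !orbT.
  rewrite -!(@stage_label G n) //.
  exact: (coherent_trans (stage_coherent G n)).
Qed.

Lemma label_mid G x y A B P : x <> y -> label G x y = Some P ->
  derivable (P |-- Prod A B) ->
  exists2 z, label G x z = Some [:: A] & label G z y = Some [:: B].
Proof.
move=> nxy Exy dP; pose n := maxn (level x) (level y).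
have lx : level x <= n by rewrite leq_maxl.
have ly : level y <= n by rewrite leq_maxr.
(* At stage [n] both ends are already present, so the pair is a genuine defect and [z] is
   inserted. *)
pose z := Mid n x A B y; pose l := stage G n.
have iz : inserted n l z by split=> //; split=> //; exists P.
have ix := @level_not_inserted n l x lx; have iy := @level_not_inserted n l y ly.
have rl := coherent_refl (stage_coherent G n).
exists z; rewrite -(@stage_label G n.+1) //= ?(leqW lx) ?(leqW ly) //.
  rewrite (@extend_via _ _ _ _ x x [::] [:: A] [::]) ?exit_old //; first by case.
  by rewrite /entry; case: asboolP.
rewrite (@extend_via _ _ _ _ y y [:: B] [::] [::]) ?entry_old //.
  by case=> _ zy; rewrite zy in iz.
by rewrite /exit; case: asboolP.
Qed.

(** The fresh [x] can be left only through [y]. Its stage is chosen after [z], so that [z] is old;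
    [omap] also covers an unrelated pair, which stays unrelated. *)
Lemma label_lft G y z A : exists2 x, label G x y = Some [:: A] &
  label G x z = omap (cons A) (label G y z).
Proof.
pose n := maxn (level y) (level z); pose x := Lft n A y; pose l := stage G n.
have ly : level y <= n by rewrite leq_maxl.
have lz : level z <= n by rewrite leq_maxr.
have E w : level w <= n -> label G x w = omap (cons A) (label G y w).
  move=> lw; have iw := @level_not_inserted n l w lw.
  rewrite -(@stage_label G n.+1) //= ?(leqW lw) // -(@stage_label G n) //.
  rewrite /extend; case: asboolP => [[_ xw]|_].
    by case: iw; rewrite -xw.
  rewrite entry_old // /exit; case: asboolP => //= _.
  by case: (stage G n y w) => //= P; rewrite cats0.
by exists x; rewrite E // (coherent_refl (label_coherent G)).
Qed.

Lemma label_rgt G x y A : exists2 z, label G y z = Some [:: A] &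
  label G x z = omap (rcons^~ A) (label G x y).
Proof.
pose n := maxn (level x) (level y); pose z := Rgt n y A; pose l := stage G n.
have lx : level x <= n by rewrite leq_maxl.
have ly : level y <= n by rewrite leq_maxr.
have E w : level w <= n -> label G w z = omap (rcons^~ A) (label G w y).
  move=> lw; have iw := @level_not_inserted n l w lw.
  rewrite -(@stage_label G n.+1) //= ?(leqW lw) // -(@stage_label G n) //.
  rewrite /extend; case: asboolP => [[]//|_].
  rewrite exit_old // /entry; case: asboolP => //= _.
  by case: (stage G n w y) => //= P; rewrite cats1.
by exists z; rewrite E // (coherent_refl (label_coherent G)).
Qed.

Lemma label_base G : label G (Base false) (Base true) = Some G.
Proof. by rewrite /label /=; case: asboolP => // _; case: asboolP => // -[]. Qed.

(** * The canonical model *)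

Definition cval (G : seq formula) (A : formula) : set (point * point) :=
  [set p | exists2 P, label G p.1 p.2 = Some P & derivable (P |-- A)].

Lemma cval_le G A B : derivable ([:: A] |-- B) -> cval G A `<=` cval G B.
Proof. by move=> AB p [P lP dA]; exists P => //; apply: cut1 AB. Qed.

Lemma cval_prod G A B : cval G (Prod A B) = rcomp (cval G A) (cval G B).
Proof.
apply/seteqP; split=> -[x y] /=.
  move=> [P /= lP dP]; case: (pselect (x = y)) => [xy|nxy].
    (* On a loop the label is empty, and by the slash argument [x] is its own midpoint. *)
    move: lP dP; rewrite -xy (coherent_refl (label_coherent G)) => -[<-].
    case/derivable_prod => dA dB.
    by exists x; split; exists [::] => //=; apply: coherent_refl (label_coherent G) _.
  have [z lx ly] := label_mid nxy lP dP.
  by exists z; split; [exists [:: A]|exists [:: B]] => //; apply: ax_id.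
move=> [z [[P /= lP dP] [Q /= lQ dQ]]].
have [T lT sT] := coherent_trans (label_coherent G) lP lQ.
by exists T => //; apply: (stronger_derivable sT); apply: rule_prodR.
Qed.

Lemma cval_ldiv G A B : cval G (LDiv A B) = rldiv (cval G A) (cval G B).
Proof.
apply/seteqP; split=> -[y z] /=.
  move=> [Q /= lQ dQ] x [P /= lP dP].
  have [T lT sT] := coherent_trans (label_coherent G) lP lQ.
  exists T => //; apply: (stronger_derivable sT).
  exact: (@rule_cut P [::] Q A B dP (derivable_ldiv_inv dQ)).
(* Testing [h] at the fresh predecessor makes the label [A :: Q] derive [B]. *)
move=> h; have [x lx lz] := label_lft G y z A.
have [|P /= lP dP] := h x; first by exists [:: A] => //; apply: ax_id.
move: lP; rewrite lz; case lQ: (label G y z) => [Q|] //= [EP].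
by exists Q => //; apply: rule_ldivR; rewrite EP.
Qed.

Lemma cval_rdiv G B A : cval G (RDiv B A) = rrdiv (cval G B) (cval G A).
Proof.
apply/seteqP; split=> -[x y] /=.
  move=> [P /= lP dP] z [Q /= lQ dQ].
  have [T lT sT] := coherent_trans (label_coherent G) lP lQ.
  exists T => //; apply: (stronger_derivable sT).
  have := @rule_cut Q P [::] A B dQ (derivable_rdiv_inv dP).
  by rewrite cats0.
move=> h; have [z ly lx] := label_rgt G x y A.
have [|P /= lP dP] := h z; first by exists [:: A] => //; apply: ax_id.
move: lP; rewrite lx; case lQ: (label G x y) => [Q|] //= [EP].
by exists Q => //; apply: rule_rdivR; rewrite cats1 EP.
Qed.

Lemma cval_and G A B : cval G (And A B) = cval G A `&` cval G B.
Proof.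
apply/seteqP; split=> -[x y] /=.
  by move=> h; split; apply: cval_le h;
    [apply: (@rule_andL1 [::] [::])|apply: (@rule_andL2 [::] [::])]; apply: ax_id.
(* Uniqueness of labels gives both conjuncts the same antecedent. *)
move=> [[P lP dA] [Q]]; rewrite lP => -[<-] dB.
by exists P => //; apply: rule_andR.
Qed.

Lemma cval_one_prod G A : cval G (Prod One A) = cval G A.
Proof.
apply/seteqP; split; apply: cval_le.
  by apply: (@rule_prodL [::] [::]); apply: (@rule_oneL [::]); apply: ax_id.
exact: (rule_prodR ax_one (ax_id A)).
Qed.

Lemma cval_prod_one G A : cval G (Prod A One) = cval G A.
Proof.
apply/seteqP; split; apply: cval_le.
  by apply: (@rule_prodL [::] [::]); apply: (@rule_oneL [:: A] [::]); apply: ax_id.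
exact: (rule_prodR (ax_id A) ax_one).
Qed.

(** Taking the definable relations as the family turns the closure conditions into the equations for
    [cval], and the unit and zero laws into derivabilities. The unit is larger than the diagonal: it
    also contains edges labelled [[:: One]]. *)
Definition canonical_model (G : seq formula) : ns_model.
Proof.
apply: (@NSModel point (inhabits (Base true)) (range (cval G)) _ _ _ _
         (cval G One) _ _ _ (cval G Zero) _ _ (cval G)) => //.
- by move=> _ _ [A _ <-] [B _ <-]; exists (Prod A B); rewrite ?cval_prod.
- by move=> _ _ [A _ <-] [B _ <-]; exists (LDiv A B); rewrite ?cval_ldiv.
- by move=> _ _ [B _ <-] [A _ <-]; exists (RDiv B A); rewrite ?cval_rdiv.
- by move=> _ _ [A _ <-] [B _ <-]; exists (And A B); rewrite ?cval_and.
- by move=> _ [A _ <-]; rewrite -cval_prod cval_one_prod.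
- by move=> _ [A _ <-]; rewrite -cval_prod cval_prod_one.
- by move=> _ [A _ <-]; apply: cval_le; apply: (@ax_zero [::] [::]).
- exact: cval_prod.
- exact: cval_ldiv.
- exact: cval_rdiv.
- exact: cval_and.
Defined.

Fixpoint prods (A : formula) (G : seq formula) : formula :=
  if G is B :: G' then Prod A (prods B G') else A.

Lemma derivable_prods A G : derivable (A :: G |-- prods A G).
Proof.
elim: G A => [|B G IH] A /=; first exact: ax_id.
exact: (@rule_prodR [:: A] (B :: G) _ _ (ax_id A) (IH B)).
Qed.

Lemma comp_val_prods G A D : comp_val (cval G) A D = cval G (prods A D).
Proof. by elim: D A => //= B D IH A; rewrite IH cval_prod. Qed.

Theorem theorem3p1 (s : sequent) :
  (forall M : ns_model, true_in M s) -> derivable s.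
Proof.
case: s => G B /(_ (canonical_model G)); rewrite /true_in /=.
case: G => [|A G] h.
  (* Any loop would do: its label is the empty antecedent. *)
  have [//|P /=] := h (Base true, Base true).
  by rewrite (coherent_refl (label_coherent [::])) => -[<-].
(* The initial edge is labelled by the antecedent itself, which derives its own product. *)
have [|P /=] := h (Base false, Base true); last by rewrite label_base => -[<-].
rewrite comp_val_prods; exists (A :: G); first exact: label_base.
exact: derivable_prods.
Qed.
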